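(* Let $f\ge 2$ and let $A_{i,j}$ ($i,j\in\{1,\ldots,f\}$, $i\neq j$) be a linked system of symmetric group divisible designs with parameters $(v,k,m,n,\lambda_1,\lambda_2)$, $v=mn$, such that $A_{i,j}(I_m\otimes J_n)=(I_m\otimes J_n)A_{i,j}=\frac{k}{m}J_v$ for all distinct $i,j$. Define $fv\times fv$ matrices $A_0=I_{fv}$, $A_1=I_{fm}\otimes(J_n-I_n)$, $A_2$ the block matrix whose $(i,j)$ block ($v\times v$) is $A_{i,j}$ for $i\neq j$ and $O_v$ for $i=j$, $A_3=(J_f-I_f)\otimes J_v-A_2$, and $A_4=I_f\otimes J_{mn}-I_{fm}\otimes J_n$. Then $\{A_0,A_1,A_2,A_3,A_4\}$ is a $4$-class symmetric association scheme; it is imprimitive with respect to $\mathcal{I}=\{0,1,4\}$ (i.e. $A_0+A_1+A_4=I_f\otimes J_{mn}$ is the adjacency matrix of an equivalence relation whose classes, the fibers, are the $f$ sets of size $mn$), it is uniform, and the restriction of the scheme to each equivalence class is a $2$-class imprimitive association scheme.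
   Context: $I_n,J_n,O_n$ denote the identity, all-ones and zero matrices of order $n$; $\otimes$ is the Kronecker product. A $v\times v$ $(0,1)$-matrix $A$ ($v=mn$, $m,n\ge2$, $0<k<v$) is the incidence matrix of a symmetric group divisible design with parameters $(v,k,m,n,\lambda_1,\lambda_2)$ if $AA^\top=A^\top A=kI_v+\lambda_1(I_m\otimes J_n-I_v)+\lambda_2(J_v-I_m\otimes J_n)$. A linked system of such designs is a family of $v\times v$ $(0,1)$-matrices $A_{i,j}$ ($i\ne j$ in $\{1,\ldots,f\}$) with $A_{i,j}^\top=A_{j,i}$, each an incidence matrix of such a design, such that there are integers $\sigma,\tau$ with $A_{i,j}A_{j,l}=\sigma A_{i,l}+\tau(J_v-A_{i,l})$ for all pairwise distinct $i,j,l$ (vacuous if $f=2$). A $d$-class symmetric association scheme on a finite set $X$ is a set of nonzero symmetric $(0,1)$-matrices $A_0,\ldots,A_d$ indexed by $X$ with $A_0=I$, $\sum_i A_i=J$, and $A_iA_j=\sum_k p_{i,j}^kA_k$ for nonnegative integers $p_{i,j}^k$. It is imprimitive if some $A_i$ ($i\neq0$) is the adjacency matrix of a disconnected graph; for an index set $\mathcal{I}\ni 0$ with $\sum_{j\in\mathcal{I}}A_j=I_p\otimes J_q$ ($p>1$) the $p$ blocks of size $q$ are the fibers. For fibers $U,V$, $\mathcal{I}(U,V)$ is the set of $i$ such that $A_i$ has a $1$ in some entry with row in $U$ and column in $V$, and $A_i^{UV}$ is $A_i$ with all entries outside $U\times V$ set to $0$. The scheme is uniform if the quotient scheme on fibers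 has one class and there are nonnegative integers $a_{i,j}^k$ such that $A_i^{UV}A_j^{VW}=\sum_k a_{i,j}^kA_k^{UW}$ for all fibers $U,V,W$ and $i\in\mathcal{I}(U,V)$, $j\in\mathcal{I}(V,W)$. *)

(* Defs.v *)
From mathcomp Require Import all_boot all_order all_algebra.
From mathcomp.real_closed Require Export mxtens.

Set Implicit Arguments.
Unset Strict Implicit.
Unset Printing Implicit Defensive.

Import GRing.Theory.
Local Open Scope ring_scope.

(* All matrices have rational entries, so that k / m below is an exact
   quotient.  A (0,1)-matrix of order N is a matrix over rat with rows and
   columns indexed by 'I_N; Kronecker products "*t" are those of mxtens, where
   mxtens_unindex x = (i, a) gives the block i and the position a in that block
   of an index x : 'I_(p * q). *)

Definition allones (n : nat) : 'M[rat]_n := const_mx 1.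

Definition is01 (N : nat) (M : 'M[rat]_N) : Prop :=
  forall x y, M x y = 0 \/ M x y = 1.

Definition groups (p q : nat) : 'M[rat]_(p * q) := 1%:M *t allones q.

Definition symmetric_gdd (m n k lambda1 lambda2 : nat)
    (A : 'M[rat]_(m * n)) : Prop :=
  let D := k%:R *: 1%:M
           + lambda1%:R *: (groups m n - 1%:M)
           + lambda2%:R *: (allones (m * n) - groups m n) in
  [/\ (2 <= m)%N, (2 <= n)%N, (0 < k < m * n)%N, is01 A
    & A *m A^T = D /\ A^T *m A = D].

(* The diagonal entries A i i play no role. *)
Definition linked_system (f m n k lambda1 lambda2 : nat)
    (A : 'I_f -> 'I_f -> 'M[rat]_(m * n)) : Prop :=
  [/\ forall i j, i != j -> (A i j)^T = A j i,
      forall i j, i != j -> symmetric_gdd k lambda1 lambda2 (A i j)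
    & exists sigma tau : int, forall i j l, i != j -> j != l -> i != l ->
        A i j *m A j l =
          sigma%:~R *: A i l + tau%:~R *: (allones (m * n) - A i l)].

Definition assoc_scheme (d N : nat) (A : 'I_d.+1 -> 'M[rat]_N) : Prop :=
  [/\ forall i, [/\ A i != 0, (A i)^T = A i & is01 (A i)],
      A ord0 = 1%:M,
      \sum_i A i = allones N
    & exists p : 'I_d.+1 -> 'I_d.+1 -> 'I_d.+1 -> nat,
        forall i j, A i *m A j = \sum_k (p i j k)%:R *: A k].

Definition graph_of (N : nat) (M : 'M[rat]_N) : rel 'I_N :=
  fun x y => M x y == 1.

Definition disconnected (N : nat) (M : 'M[rat]_N) : Prop :=
  exists x y, ~~ connect (graph_of M) x y.

Definition imprimitive (d N : nat) (A : 'I_d.+1 -> 'M[rat]_N) : Prop :=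
  exists2 i, i != ord0 & disconnected (A i).

Definition imprimitive_wrt (d p q : nat) (A : 'I_d.+1 -> 'M[rat]_(p * q))
    (I : {set 'I_d.+1}) : Prop :=
  [/\ imprimitive A, ord0 \in I, (1 < p)%N & \sum_(i in I) A i = groups p q].

Definition fiber_rel (d N : nat) (A : 'I_d.+1 -> 'M[rat]_N)
    (I : {set 'I_d.+1}) : rel 'I_N :=
  graph_of (\sum_(i in I) A i).

Definition fibers (d N : nat) (A : 'I_d.+1 -> 'M[rat]_N)
    (I : {set 'I_d.+1}) : {set {set 'I_N}} :=
  equivalence_partition (fiber_rel A I) [set: 'I_N].

(* The set I(U,V). *)
Definition rels (d N : nat) (A : 'I_d.+1 -> 'M[rat]_N) (U V : {set 'I_N}) :
    {set 'I_d.+1} :=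
  [set i | [exists x in U, [exists y in V, A i x y == 1]]].

(* M^{UV}: same order as M, zero outside U x V. *)
Definition cut (N : nat) (U V : {set 'I_N}) (M : 'M[rat]_N) : 'M[rat]_N :=
  \matrix_(x, y) (if (x \in U) && (y \in V) then M x y else 0).

(* The submatrix of M indexed by U x U. *)
Definition restrict (N : nat) (U : {set 'I_N}) (M : 'M[rat]_N) : 'M[rat]_#|U| :=
  mxsub enum_val enum_val M.

(* The restriction to U consists of the matrices A_i restricted to U for the
   relations i that occur within U, taken as a set and numbered in some way. *)
Definition imprimitive_restriction (d' d N : nat) (A : 'I_d.+1 -> 'M[rat]_N)
    (U : {set 'I_N}) : Prop :=
  exists B : 'I_d'.+1 -> 'M[rat]_#|U|,
    [/\ codom B =i [seq restrict U (A i) | i in rels A U U],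
        assoc_scheme B & imprimitive B].

(* The quotient of A_i has a 1 at (U,V) exactly when A_i occurs between the
   fibers U and V.  Different i may have the same quotient, so the quotient
   scheme is the set of these matrices. *)
Definition quotient_mx (d N : nat) (A : 'I_d.+1 -> 'M[rat]_N)
    (I : {set 'I_d.+1}) (i : 'I_d.+1) : 'M[rat]_#|fibers A I| :=
  \matrix_(a, b) (i \in rels A (enum_val a) (enum_val b))%:R.

Definition quotient_has_classes (d' d N : nat) (A : 'I_d.+1 -> 'M[rat]_N)
    (I : {set 'I_d.+1}) : Prop :=
  exists B : 'I_d'.+1 -> 'M[rat]_#|fibers A I|,
    codom B =i codom (quotient_mx A I) /\ assoc_scheme B.

Definition uniform (d N : nat) (A : 'I_d.+1 -> 'M[rat]_N)
    (I : {set 'I_d.+1}) : Prop :=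
  quotient_has_classes 1 A I /\
  exists a : 'I_d.+1 -> 'I_d.+1 -> 'I_d.+1 -> nat,
    forall U V W, U \in fibers A I -> V \in fibers A I -> W \in fibers A I ->
    forall i j, i \in rels A U V -> j \in rels A V W ->
      cut U V (A i) *m cut V W (A j) = \sum_k (a i j k)%:R *: cut U W (A k).

Arguments assoc_scheme d {N} A.

(* Matrices given as Kronecker products of order (f m) n are transported to
   order f (m n). *)
Definition reassoc (f m n : nat) (M : 'M[rat]_(f * m * n)) :
    'M[rat]_(f * (m * n)) :=
  castmx (esym (mulnA f m n), esym (mulnA f m n)) M.

Section LinkedScheme.
Variables (f m n : nat) (A : 'I_f -> 'I_f -> 'M[rat]_(m * n)).

Definition LA0 : 'M[rat]_(f * (m * n)) := 1%:M.

Definition LA1 : 'M[rat]_(f * (m * n)) :=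
  reassoc ((1%:M : 'M[rat]_(f * m)) *t (allones n - 1%:M)).

Definition LA2 : 'M[rat]_(f * (m * n)) :=
  \matrix_(x, y)
    let: (i, a) := mxtens_unindex x in
    let: (j, b) := mxtens_unindex y in
    if i == j then 0 else A i j a b.

Definition LA3 : 'M[rat]_(f * (m * n)) :=
  (allones f - 1%:M) *t allones (m * n) - LA2.

Definition LA4 : 'M[rat]_(f * (m * n)) :=
  groups f (m * n) - reassoc (groups (f * m) n).

Definition linked_scheme : 'I_5 -> 'M[rat]_(f * (m * n)) :=
  tnth [tuple LA0; LA1; LA2; LA3; LA4].

End LinkedScheme.

Definition fiber_index : {set 'I_5} :=
  [set i : 'I_5 | val i \in [:: 0; 1; 4]%N].

(* Main.v *)
(* All products are computed blockwise.  Within a fiber the blocks are I, G - I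
   and J - G, with G the group matrix, and between two fibers they are A_{i,j}
   and J - A_{i,j}.  The hypotheses express every product of two composable
   blocks as a rational combination of the blocks at the same position, with
   coefficients that do not depend on the fibers.  As the blocks at a position
   are (0,1)-matrices with sum J, a coefficient that matters is an entry of a
   product of (0,1)-matrices, hence a natural number.  This is uniformity;
   summing over the intermediate fiber multiplies the coefficients by the number
   of admissible choices and gives the intersection numbers of the scheme. *)
Require Import Defs.
From mathcomp Require Import all_boot all_order all_algebra.
From mathcomp Require Import ring.

Set Implicit Arguments.
Unset Strict Implicit.
Unset Printing Implicit Defensive.

Import GRing.Theory Num.Theory.
Local Open Scope ring_scope.

(** * Index arithmetic and products of [groups] and [allones] *)

Lemma sum_mxtens (V : nmodType) (p q : nat) (F : 'I_(p * q) -> V) :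
  \sum_z F z = \sum_i \sum_a F (mxtens_index (i, a)).
Proof.
rewrite pair_big (reindex (@mxtens_index p q)) /=.
  by apply: eq_bigr => -[].
by exists (@mxtens_unindex p q) => z _; rewrite (mxtens_indexK, mxtens_unindexK).
Qed.

Lemma groupsE (p q : nat) (x y : 'I_(p * q)) :
  groups p q x y = ((mxtens_unindex x).1 == (mxtens_unindex y).1)%:R.
Proof. by rewrite !mxE mulr1. Qed.

Lemma reassocE (f m n : nat) (M : 'M[rat]_(f * m * n)) i a b i' a' b' :
  reassoc M (mxtens_index (i, mxtens_index (a, b)))
            (mxtens_index (i', mxtens_index (a', b')))
  = M (mxtens_index (mxtens_index (i, a), b))
      (mxtens_index (mxtens_index (i', a'), b')).
Proof.
(* Both nestings of the triple (i, a, b) have the value imn + an + b. *)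
rewrite castmxE; congr (M _ _); apply: val_inj => /=;
  by rewrite mulnDl mulnA addnA.
Qed.

Lemma trmx_groups (p q : nat) : (groups p q)^T = groups p q.
Proof. by apply/matrixP => x y; rewrite mxE !groupsE eq_sym. Qed.

Lemma trmx_allones (p : nat) : (allones p)^T = allones p.
Proof. exact: trmx_const. Qed.

Lemma mulmx_allones (p : nat) : allones p *m allones p = p%:R *: allones p.
Proof.
apply/matrixP => x y; rewrite !mxE (eq_bigr (fun=> 1)) => [|z _].
  by rewrite sumr_const card_ord mulr1.
by rewrite !mxE mulr1.
Qed.

Lemma mulmx_groups (p q : nat) : groups p q *m groups p q = q%:R *: groups p q.
Proof.
rewrite /groups tensmx_mul mul1mx mulmx_allones.
by apply/matrixP => x y; rewrite !mxE mulrCA.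
Qed.

Lemma mulmx_groups_allones (p q : nat) :
  groups p q *m allones (p * q) = q%:R *: allones (p * q).
Proof.
have -> : allones (p * q) = allones p *t allones q.
  by apply/matrixP => x y; rewrite !mxE mulr1.
rewrite /groups tensmx_mul mul1mx mulmx_allones.
by apply/matrixP => x y; rewrite !mxE mulrCA.
Qed.

Lemma mulmx_allones_groups (p q : nat) :
  allones (p * q) *m groups p q = q%:R *: allones (p * q).
Proof.
by apply: trmx_inj; rewrite trmx_mul linearZ /= trmx_groups trmx_allones
  mulmx_groups_allones.
Qed.

(** * (0,1)-matrices and natural coefficients *)

Lemma is01_natr (N : nat) (M : 'M[rat]_N) x y : is01 M -> M x y \is a Num.nat.
Proof. by move=> /(_ x y)[] ->. Qed.

Lemma mulmx_is01_natr (N : nat) (M M' : 'M[rat]_N) x y :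
  is01 M -> is01 M' -> (M *m M') x y \is a Num.nat.
Proof.
by move=> M01 M'01; rewrite mxE rpred_sum // => z _; rewrite rpredM ?is01_natr.
Qed.

Lemma is01P (N : nat) (M : 'M[rat]_N) :
  is01 M -> M != 0 -> exists x y, M x y = 1.
Proof.
move=> M01 M0; case: (pickP [pred z | M z.1 z.2 == 1]) => [[x y] /eqP /= Mxy|Mn1].
  by exists x, y.
case/eqP: M0; apply/matrixP => x y; rewrite mxE.
by case: (M01 x y) => // Mxy; have:= Mn1 (x, y); rewrite /= Mxy eqxx.
Qed.

(* The supports of the [B t] partition the entries, so each coefficient that
   matters is an entry of [X]. *)
Lemma truncn_combination (N : nat) (I : finType) (X : 'M[rat]_N)
    (B : I -> 'M[rat]_N) (c : I -> rat) :
  (forall x y, X x y \is a Num.nat) -> (forall t, is01 (B t)) ->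
  \sum_t B t = allones N -> X = \sum_t c t *: B t ->
  X = \sum_t (Num.truncn (c t))%:R *: B t.
Proof.
move=> X_nat B01 B_sum X_def; apply/matrixP => x y.
have Bxy_sum : \sum_t B t x y = 1 by rewrite -summxE B_sum mxE.
have [t0 Bt0] : exists t0, B t0 x y = 1.
  case: (pickP (fun t => B t x y == 1)) => [t0 /eqP|Bn1]; first by exists t0.
  move: Bxy_sum; rewrite big1 => [/eqP|t _]; first by rewrite eq_sym oner_eq0.
  by case: (B01 t x y) => // Bt; have:= Bn1 t; rewrite Bt eqxx.
have Bt t : t != t0 -> B t x y = 0.
  move=> tt0; move: Bxy_sum; rewrite (bigD1 t0) //= Bt0 -[RHS]addr0 => /addrI.
  move=> /psumr_eq0P; apply => // t' _; exact/natr_ge0/is01_natr.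
have sumE (e : I -> rat) : (\sum_t e t *: B t) x y = e t0.
  rewrite summxE (bigD1 t0) //= big1 => [|t /Bt Bt0']; rewrite !mxE ?Bt0' ?mulr0 //.
  by rewrite Bt0 mulr1 addr0.
by rewrite sumE truncnK ?X_def ?sumE // -(sumE c) -X_def.
Qed.

(** * Blocks of the scheme and their products *)

Section Blocks.
Variables (f m n : nat) (A : 'I_f -> 'I_f -> 'M[rat]_(m * n)).

Let G := groups m n.
Let J := allones (m * n).

(* Only meaningful when the relation [t] occurs between the fibers [i] and [j],
   which is what [block] tests. *)
Definition cell (t : 'I_5) (i j : 'I_f) : 'M[rat]_(m * n) :=
  tnth [tuple 1%:M; G - 1%:M; A i j; J - A i j; J - G] t.

Definition block (t : 'I_5) (i j : 'I_f) : 'M[rat]_(m * n) :=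
  if (t \in fiber_index) == (i == j) then cell t i j else 0.

(** Splitting each position into its group and its place there turns the five definitions, Kronecker
    or blockwise, into tests of equality of coordinates, apart from the entries of [A i j]. *)
Lemma linked_schemeE t i j a b :
  linked_scheme A t (mxtens_index (i, a)) (mxtens_index (j, b)) =
  block t i j a b.
Proof.
case: (mxtens_indexP a) (mxtens_indexP b) => a1 a2 [b1 b2].
rewrite /block /cell inE.
case: t => -[|[|[|[|[|//]]]]] lt_t; rewrite !(tnth_nth 0) /= ?reassocE ?mxE
  ?reassocE ?mxE ?groupsE ?mxtens_indexK ?(can_eq (@mxtens_indexK _ _)) ?xpair_eqE /=;
  have [_|_] := eqVneq i j; rewrite ?mxE ?groupsE ?mxtens_indexK /=
  ?(can_eq (@mxtens_indexK _ _)) ?xpair_eqE ?mxE //=;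
  by have [_|_] := eqVneq a1 b1; rewrite ?mul1r ?mul0r ?mulr1 ?subrr ?subr0.
Qed.

Hypothesis f_ge2 : (2 <= f)%N.
Variables k lambda1 lambda2 : nat.
Hypothesis A_linked : linked_system k lambda1 lambda2 A.
Hypothesis A_groups : forall i j, i != j ->
  A i j *m G = (k%:R / m%:R) *: J /\ G *m A i j = (k%:R / m%:R) *: J.

Lemma ex_neq (i : 'I_f) : exists j, i != j.
Proof.
have [-> | i_neq] := eqVneq i (Ordinal (ltnW f_ge2)).
  by exists (Ordinal f_ge2).
by exists (Ordinal (ltnW f_ge2)).
Qed.

(** The bounds are stated only inside the designs [A i j] with i != j; having two fibers provides
    one design to read them from. *)
Lemma linked_params : [/\ (2 <= m)%N, (2 <= n)%N & (0 < k < m * n)%N].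
Proof.
have [_ gdd _] := A_linked.
by have [j /gdd[]] := ex_neq (Ordinal f_ge2).
Qed.

Let m_neq0 : m%:R != 0 :> rat.
Proof. by have [/ltnW] := linked_params; rewrite pnatr_eq0 lt0n. Qed.

Let n_neq0 : n%:R != 0 :> rat.
Proof. by have [_ /ltnW] := linked_params; rewrite pnatr_eq0 lt0n. Qed.

(** The hypothesis on groups fixes the row sums: as G J = n J, one has A J = n^-1 (A G) J = n^-1
    (k/m) J J, and J J = mn J. *)
Lemma mulmx_linked_allones i j : i != j -> A i j *m J = k%:R *: J.
Proof.
move=> /A_groups[AG _].
have -> : J = n%:R^-1 *: (G *m J).
  by rewrite mulmx_groups_allones scalerA mulVf // scale1r.
rewrite -scalemxAr mulmxA AG -scalemxAl mulmx_allones mulmx_groups_allones.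
by rewrite !scalerA natrM; congr (_ *: _); field; rewrite m_neq0 n_neq0.
Qed.

Lemma mulmx_allones_linked i j : i != j -> J *m A i j = k%:R *: J.
Proof.
have [A_tr _ _] := A_linked.
move=> ij; apply: trmx_inj; rewrite trmx_mul linearZ /= trmx_allones A_tr //.
by rewrite mulmx_linked_allones // eq_sym.
Qed.

(* [coef sigma tau t u w] is the coefficient of the relation [w] in the product
   of a block of [t] and a block of [u]: the relations [w] inside a fiber and
   those between fibers never compete, since the position of the product
   decides which of them occur. *)
Definition coef (sigma tau : rat) (t u w : 'I_5) : rat :=
  let K : rat := k%:R in let q := K / m%:R in
  let M : rat := m%:R in let N : rat := n%:R in
  let L1 : rat := lambda1%:R in let L2 : rat := lambda2%:R in
  let V := M * N in
  let r11 := [:: N - 1; N - 2; 0; 0; 0] in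
  let r12 := [:: 0; 0; q - 1; q; 0] in
  let r13 := [:: 0; 0; N - q; N - 1 - q; 0] in
  let r14 := [:: 0; 0; 0; 0; N - 1] in
  let r22 := [:: K; L1; sigma; tau; L2] in
  let r23 := [:: 0; K - L1; K - sigma; K - tau; K - L2] in
  let r24 := [:: 0; 0; (M - 1) * q; (M - 1) * q; 0] in
  let r33 := [:: V - K; V - 2 * K + L1; V - 2 * K + sigma; V - 2 * K + tau;
                 V - 2 * K + L2] in
  let r34 := [:: 0; 0; (M - 1) * (N - q); (M - 1) * (N - q); 0] in
  let r44 := [:: (M - 1) * N; (M - 1) * N; 0; 0; (M - 2) * N] in
  let id s : seq rat := [seq (i == s)%:R | i <- iota 0 5] in
  let table : seq (seq (seq rat)) :=
    [:: [:: id 0; id 1; id 2; id 3; id 4];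
        [:: id 1; r11; r12; r13; r14];
        [:: id 2; r12; r22; r23; r24];
        [:: id 3; r13; r23; r33; r34];
        [:: id 4; r14; r24; r34; r44]]%N in
  nth 0 (nth [::] (nth [::] table t) u) w.

(** The condition on [t] excludes [A i i] and [J - A i i], whose entries are unconstrained. The
    differences are (0,1) since I <= G <= J and A <= J entrywise. *)
Lemma cell01 t i j : (t \in fiber_index) = (i == j) -> is01 (cell t i j).
Proof.
have [_ A_gdd _] := A_linked.
rewrite /cell !(tnth_nth 0) /= !inE /= => tij a b.
case: t tij => -[|[|[|[|[|//]]]]] lt_t /= /esym ij; rewrite ?mxE ?groupsE.
- by case: eqP; [right | left].
- have [-> | _] := eqVneq a b; rewrite ?eqxx ?subrr ?subr0; first by left.
  by case: eqP; [right | left].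
- by have [_ _ _ A01 _] := A_gdd _ _ (negbT ij).
- have [_ _ _ /(_ a b)[] -> _] := A_gdd _ _ (negbT ij); rewrite ?subr0 ?subrr;
  by [right | left].
- by case: eqP; rewrite ?subr0 ?subrr; [left | right].
Qed.

Lemma block01 t i j : is01 (block t i j).
Proof.
rewrite /block; case: eqP => [/cell01 // | _ a b]; by left; rewrite mxE.
Qed.

Lemma sum_block i j : \sum_t block t i j = J.
Proof.
rewrite !big_ord_recr big_ord0 /block /cell !(tnth_nth 0) /= !inE /=.
case: (i == j); rewrite /=; apply/matrixP => a b; rewrite !mxE; ring.
Qed.

Lemma trmx_block t i j : (block t i j)^T = block t j i.
Proof.
have [A_tr _ _] := A_linked.
rewrite /block (eq_sym j); case: eqP => [|_]; last exact: trmx0.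
rewrite /cell !(tnth_nth 0) /= !inE /=.
case: t => -[|[|[|[|[|//]]]]] lt_t /= /esym ij;
  by rewrite ?linearB /= ?trmx1 ?trmx_groups ?trmx_allones ?(A_tr _ _ (negbT ij)).
Qed.

(** A group has two places as n >= 2, and there are two groups as m >= 2. Between fibers, A = 0 or A
    = J would give row sums 0 or mn, against 0 < k < mn. *)
Lemma block_neq0 t i j :
  (t \in fiber_index) = (i == j) -> exists a b, block t i j a b = 1.
Proof.
have [m_ge2 n_ge2 /andP[k_gt0 k_lt]] := linked_params.
have J_neq0 (c : rat) : c *: J = 0 -> c = 0.
  move=> cJ; have: (c *: J) (mxtens_index (Ordinal m_ge2, Ordinal n_ge2))
   (mxtens_index (Ordinal m_ge2, Ordinal n_ge2)) = 0 by rewrite cJ mxE.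
  by rewrite !mxE mulr1.
move=> tij; apply: is01P; first exact: block01.
rewrite /block tij eqxx /cell !(tnth_nth 0) /=.
pose x00 := mxtens_index (Ordinal (ltnW m_ge2), Ordinal (ltnW n_ge2)).
pose x01 := mxtens_index (Ordinal (ltnW m_ge2), Ordinal n_ge2).
pose x10 := mxtens_index (Ordinal m_ge2, Ordinal (ltnW n_ge2)).
case: t tij => -[|[|[|[|[|//]]]]] lt_t /=; rewrite !inE /= => /esym ij;
  apply/eqP => E.
- by have:= congr1 (fun M : 'M_(m * n) => M x00 x00) E; rewrite !mxE eqxx.
- have:= congr1 (fun M : 'M_(m * n) => M x00 x01) E.
  by rewrite /x00 /x01 !mxE (can_eq (@mxtens_indexK _ _)) !mxtens_indexK.
- have:= mulmx_linked_allones (negbT ij); rewrite E mul0mx => /esym /J_neq0 /eqP.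
  by rewrite pnatr_eq0 -leqn0 leqNgt k_gt0.
- have:= mulmx_linked_allones (negbT ij).
  rewrite -(subKr J (A i j)) E subr0 mulmx_allones => /eqP.
  rewrite -subr_eq0 -scalerBl => /eqP /J_neq0 /eqP; rewrite subr_eq0 eqr_nat.
  by rewrite eqn_leq leqNgt k_lt.
- have:= congr1 (fun M : 'M_(m * n) => M x00 x10) E.
  by rewrite /x00 /x10 !mxE !mxtens_indexK.
Qed.

Lemma mulmx_cell : exists sigma tau : rat, forall i j l t u,
  (t \in fiber_index) = (i == j) -> (u \in fiber_index) = (j == l) ->
  cell t i j *m cell u j l = \sum_w coef sigma tau t u w *: block w i l.
Proof.
have [A_tr A_gdd [sigma [tau AAA]]] := A_linked.
exists sigma%:~R, tau%:~R => i j l t u.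
have GG : G *m G = n%:R *: G by exact: mulmx_groups.
have GJ : G *m J = n%:R *: J by exact: mulmx_groups_allones.
have JG : J *m G = n%:R *: J by exact: mulmx_allones_groups.
have JJ : J *m J = (m%:R * n%:R) *: J by rewrite -natrM; exact: mulmx_allones.
pose dist := (mulmxBl, mulmxBr, mul1mx, mulmx1).
rewrite !big_ord_recr big_ord0 /block /cell !(tnth_nth 0) /= !inE /=.
have [<- | ij] := eqVneq i j; have [<- | jl] := eqVneq _ l;
  rewrite ?eqxx ?(negbTE ij) ?(negbTE jl) /=.
- case: t => -[|[|[|[|[|//]]]]] lt_t //;
  case: u => -[|[|[|[|[|//]]]]] lt_u //= _ _;
  rewrite /coef /= ?(dist, GG, GJ, JG, JJ);
  apply/matrixP => x y; rewrite !mxE; ring.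
- have [AG GA] := A_groups jl; have AJ := mulmx_linked_allones jl;
  have JA := mulmx_allones_linked jl.
  case: t => -[|[|[|[|[|//]]]]] lt_t //;
  case: u => -[|[|[|[|[|//]]]]] lt_u //= _ _;
  rewrite /coef /= ?(dist, GG, GJ, JG, JJ, GA, JA);
  apply/matrixP => x y; rewrite !mxE; field; by rewrite ?m_neq0.
- have [AG GA] := A_groups ij; have AJ := mulmx_linked_allones ij;
  have JA := mulmx_allones_linked ij.
  case: t => -[|[|[|[|[|//]]]]] lt_t //;
  case: u => -[|[|[|[|[|//]]]]] lt_u //= _ _;
  rewrite /coef /= ?(dist, GG, GJ, JG, JJ, AG, AJ);
  apply/matrixP => x y; rewrite !mxE; field; by rewrite ?m_neq0.
- have AJ := mulmx_linked_allones ij.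
  have JA := mulmx_allones_linked jl.
  (* Back at the first fiber, [A j l] is the transpose of [A i j] and the design equation applies;
     otherwise the three fibers are distinct and the linking equation does. *)
  have [il | il] := eqVneq i l.
    subst l; have AA : A i j *m A j i = k%:R *: 1%:M
           + lambda1%:R *: (G - 1%:M) + lambda2%:R *: (J - G).
      by have [_ _ _ _ []] := A_gdd _ _ ij; rewrite A_tr.
    case: t => -[|[|[|[|[|//]]]]] lt_t //;
    case: u => -[|[|[|[|[|//]]]]] lt_u //= _ _;
    rewrite /coef /= ?(dist, JJ, AJ, JA, AA);
    apply/matrixP => x y; rewrite !mxE; ring.
  have AA := AAA _ _ _ ij jl il.
  case: t => -[|[|[|[|[|//]]]]] lt_t //;
  case: u => -[|[|[|[|[|//]]]]] lt_u //= _ _;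
  rewrite /coef /= ?(dist, JJ, AJ, JA, AA);
  apply/matrixP => x y; rewrite !mxE; ring.
Qed.

(** Products of (0,1)-blocks have natural entries, so by [truncn_combination] the rational
    coefficients may be truncated: one that changes only multiplies zero blocks. *)
Lemma mul_linked_block : exists c : 'I_5 -> 'I_5 -> 'I_5 -> nat,
  forall i j l t u,
  block t i j *m block u j l =
  if ((t \in fiber_index) == (i == j)) && ((u \in fiber_index) == (j == l))
  then \sum_w (c t u w)%:R *: block w i l else 0.
Proof.
have [sigma [tau cellM]] := mulmx_cell.
(* The choice depends on [t], [u] and [w] alone, not on the fibers. It also gives natural numbers
   where no product constrains the coefficient, as for [sigma] and [tau] when f = 2. *)
exists (fun t u w => Num.truncn (coef sigma tau t u w)) => i j l t u.
case: ifPn => [/andP[/eqP tij /eqP ujl]|].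
  apply: truncn_combination; last by rewrite /block tij ujl !eqxx cellM.
  - by move=> x y; apply: mulmx_is01_natr; exact: block01.
  - by move=> w; exact: block01.
  exact: sum_block.
by rewrite negb_and /block => /orP[] /negbTE ->; rewrite ?mul0mx ?mulmx0.
Qed.

(* The number of intermediate fibers [j] between fibers [i] and [l], in terms of
   whether [i = j], [j = l] and [i = l]. *)
Definition mid_count (tI uI wI : bool) : nat :=
  (if wI then if tI != uI then 0 else if tI then 1 else f.-1
   else if tI && uI then 0 else if tI || uI then 1 else f.-2)%N.

Lemma card_mid (tI uI : bool) (i l : 'I_f) :
  #|[pred j | (tI == (i == j)) && (uI == (j == l))]| = mid_count tI uI (i == l).
Proof.
rewrite /mid_count; have [-> | il] := eqVneq i l.
  case: tI uI => -[] /=.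
  - by rewrite -(card1 l); apply: eq_card => j; rewrite !inE (eq_sym j); case: (l == j).
  - by apply: eq_card0 => j; rewrite !inE (eq_sym j); case: (l == j).
  - by apply: eq_card0 => j; rewrite !inE (eq_sym j); case: (l == j).
  - rewrite -[in RHS](card_ord f) -(cardC1 l).
    by apply: eq_card => j; rewrite !inE (eq_sym j); case: (l == j).
case: tI uI => -[] /=.
- by apply: eq_card0 => j; rewrite !inE; have [<-|//] := eqVneq i j; rewrite (negbTE il).
- rewrite -(card1 i); apply: eq_card => j; rewrite !inE (eq_sym j i).
  by have [<-|//] := eqVneq i j; rewrite (negbTE il).
- rewrite -(card1 l); apply: eq_card => j; rewrite !inE andbC.
  by case: (eqVneq j l) => // ->; rewrite (negbTE il).
(* With both factors between fibers, the middle fiber is any one other than i and l. *)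
have -> : f.-2 = (#|'I_f| - #|[set i; l]|)%N by rewrite cards2 il card_ord subn2.
rewrite -cardsT -cardsDS ?subsetT //; apply: eq_card => j; rewrite !inE andbT.
by rewrite negb_or (eq_sym i) ; case: (j == i); case: (j == l).
Qed.

Lemma assoc_linked_scheme : assoc_scheme 4 (linked_scheme A).
Proof.
have [c blockM] := mul_linked_block.
split.
- move=> t; split.
  (* A relation inside fibers is tested on a diagonal block, any other on an off-diagonal one. *)
  + have [j ij] : exists j, (t \in fiber_index) = (Ordinal f_ge2 == j).
      case: (t \in _); first by exists (Ordinal f_ge2); rewrite eqxx.
      by have [j /negbTE <-] := ex_neq (Ordinal f_ge2); exists j.
    have [a [b tab]] := block_neq0 ij.
    apply/eqP => /matrixP /(_ (mxtens_index (Ordinal f_ge2, a)) (mxtens_index (j, b))).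
    by rewrite linked_schemeE tab mxE => /eqP; rewrite oner_eq0.
  + apply/matrixP => x y; case: (mxtens_indexP x) (mxtens_indexP y) => i a [j b].
    by rewrite mxE !linked_schemeE -trmx_block mxE.
  + move=> x y; case: (mxtens_indexP x) (mxtens_indexP y) => i a [j b].
    by rewrite linked_schemeE; apply: block01.
- by rewrite /linked_scheme (tnth_nth 0).
- apply/matrixP => x y; case: (mxtens_indexP x) (mxtens_indexP y) => i a [j b].
  rewrite summxE (eq_bigr (fun t => block t i j a b)) => [|t _].
    by rewrite -summxE sum_block !mxE.
  by rewrite linked_schemeE.
(* The coefficient for one middle fiber is multiplied by the number of middle fibers. Membership of
   [w] stands in for i = l, as the number may not depend on positions; where the two disagree, the
   block of [w] is zero. *)
exists (fun t u w => (mid_count (t \in fiber_index) (u \in fiber_index)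
                        (w \in fiber_index) * c t u w)%N) => t u.
apply/matrixP => x y; case: (mxtens_indexP x) (mxtens_indexP y) => i a [l b].
transitivity ((\sum_j block t i j *m block u j l) a b).
  rewrite summxE mxE sum_mxtens; apply: eq_bigr => j _; rewrite mxE.
  by apply: eq_bigr => z _; rewrite !linked_schemeE.
rewrite (eq_bigr _ (fun j _ => blockM i j l t u)) -big_mkcond sumr_const card_mid.
rewrite mulmxnE !summxE -sumrMnl; apply: eq_bigr => w _.
rewrite [in RHS]mxE linked_schemeE [in LHS]mxE /block.
have [-> | _] := eqVneq (w \in fiber_index) (i == l); last by rewrite mxE !mulr0 mul0rn.
by rewrite natrM -mulrA [RHS]mulr_natl.
Qed.
End Blocks.

(** * Disconnected graphs, restrictions and the complete graph *)

(** By induction [h] is constant along paths, so points with different values lie in different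
    components. *)
Lemma disconnected_inv (N : nat) (T : eqType) (h : 'I_N -> T) (M : 'M[rat]_N)
    x y :
  (forall x y, M x y = 1 -> h x = h y) -> h x != h y -> disconnected M.
Proof.
move=> M_h hxy; exists x, y; apply: contra hxy => /connectP[p].
elim: p x => [|z p IHp] x /= => [_ -> // | /andP[/eqP /M_h -> /IHp]]; exact.
Qed.

(** Cutting discards exactly the middle indices outside U. Thus the restricted scheme can take its
    intersection numbers from uniformity. *)
Lemma mulmx_restrict (N : nat) (U : {set 'I_N}) (M M' : 'M[rat]_N) :
  restrict U M *m restrict U M' = restrict U (cut U U M *m cut U U M').
Proof.
apply/matrixP => x y; rewrite !mxE [RHS](bigID [in U]) /= [X in _ + X]big1 => [|z zU].
  rewrite addr0 [RHS]big_enum_val /=; apply: eq_bigr => z _.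
  by rewrite !mxE !enum_valP.
by rewrite !mxE (negbTE zU) andbF mul0r.
Qed.

(** The scheme of the complete graph, to be used for the quotient on fibers. *)
Lemma assoc_scheme_trivial (N : nat) : (2 <= N)%N ->
  assoc_scheme 1 (tnth [tuple 1%:M; allones N - 1%:M]).
Proof.
move=> N_ge2; pose x0 := Ordinal (ltnW N_ge2); pose x1 := Ordinal N_ge2.
split.
- case=> -[|[|//]] lt_t; rewrite (tnth_nth 0) /=; split.
  + by apply/eqP => /matrixP /(_ x0 x0); rewrite !mxE.
  + exact: trmx1.
  + by move=> x y; rewrite mxE; case: eqP; [right | left].
  + by apply/eqP => /matrixP /(_ x0 x1); rewrite !mxE.
  + by rewrite linearB /= trmx1 trmx_allones.
  + by move=> x y; rewrite !mxE; case: eqP; rewrite ?subrr ?subr0; [left | right].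
- by rewrite (tnth_nth 0).
- by rewrite !big_ord_recr big_ord0 !(tnth_nth 0) /= add0r addrC subrK.
(* Besides products with I, this encodes (J - I)^2 = (N - 1) I + (N - 2) (J - I); as N >= 2, [N.-2]
   is the true difference. *)
exists (fun t u w => if val t == 0 then u == w : nat
          else if val u == 0 then t == w : nat
          else if val w == 0 then N.-1 else N.-2)%N => t u.
rewrite !big_ord_recr big_ord0 !(tnth_nth 0) /= add0r.
case: t => -[|[|//]] lt_t; case: u => -[|[|//]] lt_u /=;
  rewrite ?mul1mx ?mulmx1 ?scale1r ?scale0r ?add0r ?addr0 //.
rewrite mulmxBl !mulmxBr mulmx_allones !mulmx1 mul1mx.
have -> : N.-1%:R = N%:R - 1 :> rat by rewrite -subn1 natrB // ltnW.
have -> : N.-2%:R = N%:R - 2 :> rat by rewrite -subn2 natrB.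
apply/matrixP => x y; rewrite !mxE; ring.
Qed.

(** * Fibers, uniformity, the quotient and the restrictions *)

Section Fibers.
Variables (f m n : nat) (A : 'I_f -> 'I_f -> 'M[rat]_(m * n)).
Hypothesis f_ge2 : (2 <= f)%N.
Variables k lambda1 lambda2 : nat.
Hypothesis A_linked : linked_system k lambda1 lambda2 A.
Hypothesis A_groups : forall i j, i != j ->
  A i j *m groups m n = (k%:R / m%:R) *: allones (m * n) /\
  groups m n *m A i j = (k%:R / m%:R) *: allones (m * n).

Let S := linked_scheme A.

Definition fiber (i : 'I_f) : {set 'I_(f * (m * n))} :=
  [set x | (mxtens_unindex x).1 == i].

Lemma in_fiber i j a : (mxtens_index (j, a) \in fiber i) = (j == i).
Proof. by rewrite inE mxtens_indexK. Qed.

Lemma fiber_enum i : fiber i = [set mxtens_index (i, a) | a : 'I_(m * n)].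
Proof.
apply/setP => x; case: (mxtens_indexP x) => j a; rewrite in_fiber.
by apply/eqP/imsetP => [-> | [b _ /(can_inj (@mxtens_indexK _ _))[]] //]; exists a.
Qed.

Lemma card_fiber i : #|fiber i| = (m * n)%N.
Proof.
by rewrite fiber_enum card_imset ?card_ord // => a b
  /(can_inj (@mxtens_indexK _ _))[].
Qed.

(** A point lies in only one fiber, so it suffices that each fiber has a point; m, n >= 2 supply
    one. *)
Lemma fiber_inj : injective fiber.
Proof.
have [m_ge2 n_ge2 _] := linked_params f_ge2 A_linked.
pose a := mxtens_index (Ordinal m_ge2, Ordinal n_ge2).
move=> i j /setP /(_ (mxtens_index (i, a))); rewrite !in_fiber eqxx.
by move/esym/eqP.
Qed.

(** On a diagonal block the other two relations contribute zero, so the sum equals that of all five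
    blocks, which is J; off the diagonal every term is zero. *)
Lemma sum_fiber_index : \sum_(t in fiber_index) S t = groups f (m * n).
Proof.
apply/matrixP => x y; case: (mxtens_indexP x) (mxtens_indexP y) => i a [j b].
rewrite summxE groupsE !mxtens_indexK /=.
have [-> | ij] := eqVneq i j; last first.
  rewrite big1 // => t tI; rewrite linked_schemeE /block tI (negbTE ij).
  by rewrite mxE.
transitivity ((\sum_t block A t j j) a b); last by rewrite sum_block mxE.
rewrite summxE [RHS](bigID [in fiber_index]) /= [X in _ + X]big1 ?addr0 => [|t /negbTE tI].
  by apply: eq_bigr => t _; rewrite linked_schemeE.
by rewrite /block tI eqxx mxE.
Qed.

Lemma fiber_relE x y :
  fiber_rel S fiber_index x y = ((mxtens_unindex x).1 == (mxtens_unindex y).1).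
Proof.
rewrite /fiber_rel /graph_of sum_fiber_index groupsE.
by case: ((mxtens_unindex x).1 == _).
Qed.

Lemma fibersE : fibers S fiber_index = [set fiber i | i : 'I_f].
Proof.
have [m_ge2 n_ge2 _] := linked_params f_ge2 A_linked.
pose a := mxtens_index (Ordinal m_ge2, Ordinal n_ge2).
have classE x : [set y in [set: 'I_(f * (m * n))] | fiber_rel S fiber_index x y] =
    fiber (mxtens_unindex x).1.
  by apply/setP => y; rewrite !inE fiber_relE eq_sym.
apply/setP => U; apply/imsetP/imsetP => [[x _ ->] | [i _ ->]].
  by exists (mxtens_unindex x).1 => //; exact: classE.
by exists (mxtens_index (i, a)) => //; rewrite classE mxtens_indexK.
Qed.

Lemma fibersP U : reflect (exists i, U = fiber i) (U \in fibers S fiber_index).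
Proof.
rewrite fibersE; apply: (iffP imsetP) => [[i _ ->] | [i ->]]; last by exists i.
by exists i.
Qed.

(** By [block_neq0] a relation occurs wherever its kind allows, so I(U,V) depends only on whether U
    = V. *)
Lemma mem_rels t i j :
  (t \in rels S (fiber i) (fiber j)) = ((t \in fiber_index) == (i == j)).
Proof.
rewrite inE; apply/exists_inP/eqP => [[x xi /exists_inP[y yj /eqP]] | tij].
  case: (mxtens_indexP x) (mxtens_indexP y) xi yj => i' a [j' b].
  rewrite !in_fiber linked_schemeE => /eqP -> /eqP ->; rewrite /block.
  by case: eqP => // _; rewrite mxE.
have [a [b tab]] := block_neq0 f_ge2 A_linked A_groups tij.
exists (mxtens_index (i, a)); first by rewrite in_fiber.
apply/exists_inP; exists (mxtens_index (j, b)); first by rewrite in_fiber.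
by rewrite linked_schemeE tab.
Qed.

(** A cut matrix has at most one nonzero block, so the sum over middle indices collapses to fiber j
    and [mul_linked_block] applies. *)
Lemma mulmx_cut : exists c : 'I_5 -> 'I_5 -> 'I_5 -> nat,
  forall i j l t u,
  t \in rels S (fiber i) (fiber j) -> u \in rels S (fiber j) (fiber l) ->
  cut (fiber i) (fiber j) (S t) *m cut (fiber j) (fiber l) (S u) =
  \sum_w (c t u w)%:R *: cut (fiber i) (fiber l) (S w).
Proof.
have [c blockM] := mul_linked_block f_ge2 A_linked A_groups.
exists c => i j l t u; rewrite !mem_rels => tij ujl.
apply/matrixP => x y; case: (mxtens_indexP x) (mxtens_indexP y) => i' a [l' b].
rewrite mxE summxE.
have [/andP[/eqP -> /eqP ->] | il] := boolP ((i' == i) && (l' == l)); last first.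
  rewrite !big1 // => [w | z] _; rewrite !mxE !in_fiber ?(negbTE il) ?mulr0 //.
  by move: il; case: eqP; case: eqP; rewrite ?andbF ?mul0r ?mulr0.
transitivity ((block A t i j *m block A u j l) a b).
  rewrite mxE sum_mxtens (bigD1 j) //= [X in _ + X]big1 ?addr0 => [|j' jj'].
    by apply: eq_bigr => z _; rewrite !mxE !in_fiber !eqxx !linked_schemeE.
  by rewrite big1 // => z _; rewrite !mxE !in_fiber (negbTE jj') andbF mul0r.
rewrite blockM tij ujl summxE; apply: eq_bigr => w _.
by rewrite !mxE !in_fiber !eqxx linked_schemeE.
Qed.

(** Supplies the invariant for [disconnected_inv], both on the whole scheme and on a single
    fiber. *)
Lemma linked_scheme1_group x y : S (inord 1) x y = 1 ->
  (mxtens_unindex (mxtens_unindex x).2).1 = (mxtens_unindex (mxtens_unindex y).2).1.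
Proof.
case: (mxtens_indexP x) (mxtens_indexP y) => i a [j b].
rewrite linked_schemeE !mxtens_indexK /block.
case: ifP => _; last by rewrite mxE => /eqP; rewrite eq_sym oner_eq0.
rewrite /cell (tnth_nth 0) /= inordK //= mxE groupsE.
(* Across groups the entry is 0 or -1, never 1. *)
have [// | _] := eqVneq; rewrite !mxE add0r; case: (a == b) => //.
Qed.

Lemma imprimitive_linked_scheme : imprimitive S.
Proof.
have [m_ge2 n_ge2 _] := linked_params f_ge2 A_linked.
pose o1 := Ordinal (ltnW m_ge2); pose o2 := Ordinal m_ge2; pose o := Ordinal n_ge2.
exists (inord 1); first by rewrite -val_eqE /= inordK.
apply: (disconnected_inv linked_scheme1_group
  (x := mxtens_index (Ordinal f_ge2, mxtens_index (o1, o)))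
  (y := mxtens_index (Ordinal f_ge2, mxtens_index (o2, o)))).
by rewrite !mxtens_indexK.
Qed.

(** By [mem_rels] a relation inside fibers has quotient I and one between fibers J - I, so the five
    quotients collapse to the two matrices of the complete graph. *)
Lemma quotient_linked_scheme : quotient_has_classes 1 S fiber_index.
Proof.
have card_fibers : #|fibers S fiber_index| = f.
  by rewrite fibersE card_imset ?card_ord //; exact: fiber_inj.
exists (tnth [tuple 1%:M; allones _ - 1%:M]); split; last first.
  by apply: assoc_scheme_trivial; rewrite card_fibers.
have qE t : quotient_mx S fiber_index t =
    if t \in fiber_index then 1%:M else allones _ - 1%:M.
  apply/matrixP => a b; rewrite mxE.
  have /fibersP[i Ei] := enum_valP a; have /fibersP[j Ej] := enum_valP b.
  rewrite Ei Ej mem_rels -(inj_eq fiber_inj) -Ei -Ej (inj_eq enum_val_inj).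
  by case: (t \in _); rewrite !mxE; case: (a == b); rewrite /= ?subrr ?subr0.
move=> M; apply/codomP/codomP => [[[[|[|//]] lt_s] ->] | [t ->]].
- by exists ord0; rewrite qE inE (tnth_nth 0).
- by exists (inord 2); rewrite qE inE /= inordK // (tnth_nth 0).
rewrite qE; case: ifP => _; [exists ord0 | exists ord_max];
  by rewrite (tnth_nth 0).
Qed.

(** On one fiber there remain equality, same group and different group. Products come from
    uniformity with three equal fibers, and the graph of the second relation never leaves a
    group. *)
Lemma imprimitive_restriction_fiber i : imprimitive_restriction 2 S (fiber i).
Proof.
have [m_ge2 n_ge2 _] := linked_params f_ge2 A_linked.
have [S_props S0 _ _] := assoc_linked_scheme f_ge2 A_linked A_groups.
have [c cutM] := mulmx_cut.
(* [e] numbers [fiber_index] in increasing order: 0, 1, 4. *)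
pose e : 'I_3 -> 'I_5 := tnth [tuple ord0; inord 1; ord_max].
have sum_e (V : nmodType) (F : 'I_5 -> V) :
    \sum_(t in fiber_index) F t = \sum_s F (e s).
  rewrite big_mkcond !big_ord_recr !big_ord0 /= !inE /= !addr0 /e !(tnth_nth ord0) /=.
  by congr (0 + F _ + F _ + F _); apply: val_inj; rewrite /= ?inordK.
have e_in s : e s \in fiber_index.
  by rewrite /e inE (tnth_nth ord0); case: s => -[|[|[|//]]] lt_s; rewrite /= ?inordK.
have e_rels s : e s \in rels S (fiber i) (fiber i) by rewrite mem_rels e_in eqxx.
exists (fun s => restrict (fiber i) (S (e s))); split.
- move=> M; apply/codomP/imageP => [[s ->] | [t]]; first by exists (e s).
  rewrite mem_rels eqxx eqb_id inE => tI ->.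
  case: t tI => -[|[|[|[|[|//]]]]] //= lt_t _.
  + by exists (inord 0); rewrite /e (tnth_nth ord0) inordK //=;
      congr (restrict _ (S _)); apply: val_inj.
  + by exists (inord 1); rewrite /e (tnth_nth ord0) inordK //=;
      congr (restrict _ (S _)); apply: val_inj; rewrite /= inordK.
  + by exists (inord 2); rewrite /e (tnth_nth ord0) inordK //=;
      congr (restrict _ (S _)); apply: val_inj.
- split.
  + move=> s; have [_ S_tr S01] := S_props (e s); split.
    * move: (e_rels s); rewrite inE => /exists_inP[x xi /exists_inP[y yi /eqP sxy]].
      apply/eqP => /matrixP /(_ (enum_rank_in xi x) (enum_rank_in yi y)).
      by rewrite !mxE !enum_rankK_in // sxy => /eqP; rewrite oner_eq0.
    * apply/matrixP => x y; rewrite !mxE.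
      by have /matrixP /(_ (enum_val x) (enum_val y)) := S_tr; rewrite mxE.
    * by move=> x y; rewrite mxE.
  + apply/matrixP => x y; rewrite mxE /e (tnth_nth ord0) /= [S _]S0 !mxE.
    by rewrite (inj_eq enum_val_inj).
  + apply/matrixP => x y; rewrite summxE.
    under eq_bigr do rewrite mxE.
    rewrite -(sum_e _ (fun t => S t _ _)) -summxE sum_fiber_index groupsE mxE.
    by have:= enum_valP x; have:= enum_valP y; rewrite !inE => /eqP -> /eqP ->; rewrite eqxx.
  exists (fun s s' s'' => c (e s) (e s') (e s'')) => s s'.
  rewrite mulmx_restrict (cutM i i i) ?e_rels //.
  rewrite -(sum_e _ (fun t => (c _ _ t)%:R *: restrict (fiber i) (S t))).
  (* Uniformity gives a sum over all five relations; those between fibers restrict to zero. *)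
  apply/matrixP => x y; rewrite mxE !summxE [LHS](bigID [in fiber_index]) /=.
  rewrite [X in _ + X]big1 ?addr0 => [|w wI].
    by apply: eq_bigr => w _; rewrite !mxE !enum_valP.
  rewrite !mxE !enum_valP; have:= enum_valP x; have:= enum_valP y.
  case: (mxtens_indexP (enum_val x)) (mxtens_indexP (enum_val y)) => j a [j' b].
  rewrite !in_fiber => /eqP -> /eqP ->; rewrite linked_schemeE /block (negbTE wI) eqxx.
  by rewrite mxE mulr0.
pose o1 := Ordinal (ltnW m_ge2); pose o2 := Ordinal m_ge2; pose o := Ordinal n_ge2.
have in_i a : mxtens_index (i, a) \in fiber i by rewrite in_fiber.
exists (inord 1); first by rewrite -val_eqE /= inordK.
apply: (@disconnected_inv _ _
  (fun z => (mxtens_unindex (mxtens_unindex (enum_val z)).2).1) _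
  (enum_rank_in (in_i (mxtens_index (o1, o))) (mxtens_index (i, mxtens_index (o1, o))))
  (enum_rank_in (in_i (mxtens_index (o1, o))) (mxtens_index (i, mxtens_index (o2, o))))).
  move=> x y; rewrite mxE /e (tnth_nth ord0) inordK //=; exact: linked_scheme1_group.
by rewrite !enum_rankK_in ?in_i // !mxtens_indexK.
Qed.

End Fibers.

Theorem theorem4p1 (f m n k lambda1 lambda2 : nat)
    (A : 'I_f -> 'I_f -> 'M[rat]_(m * n)) :
  (2 <= f)%N ->
  linked_system k lambda1 lambda2 A ->
  (forall i j, i != j ->
     A i j *m groups m n = (k%:R / m%:R) *: allones (m * n) /\
     groups m n *m A i j = (k%:R / m%:R) *: allones (m * n)) ->
  let S := linked_scheme A in
  let E := fiber_rel S fiber_index in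
  [/\ assoc_scheme 4 S,
      imprimitive_wrt S fiber_index,
      [/\ reflexive E, symmetric E, transitive E,
          #|fibers S fiber_index| = f
        & forall U, U \in fibers S fiber_index -> #|U| = (m * n)%N],
      uniform S fiber_index
    & forall U, U \in fibers S fiber_index -> imprimitive_restriction 2 S U].
Proof.
move=> f_ge2 A_linked A_groups S E.
have EE x y : E x y = ((mxtens_unindex x).1 == (mxtens_unindex y).1).
  exact: fiber_relE.
have inP U := fibersP f_ge2 A_linked U.
split.
- exact: (assoc_linked_scheme f_ge2 A_linked A_groups).
- split=> //; [exact: (imprimitive_linked_scheme f_ge2 A_linked) | by rewrite inE |].
  exact: sum_fiber_index.
- split.
  + by move=> x; rewrite EE.
  + by move=> x y; rewrite !EE eq_sym.
  + by move=> y x z; rewrite !EE => /eqP -> /eqP ->.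
  + rewrite (fibersE f_ge2 A_linked) card_imset ?card_ord //.
    exact: (fiber_inj f_ge2 A_linked).
  + by move=> U /inP[i ->]; exact: card_fiber.
- split; first exact: (quotient_linked_scheme f_ge2 A_linked A_groups).
  have [c cutM] := mulmx_cut f_ge2 A_linked A_groups.
  exists c => U V W /inP[i ->] /inP[j ->] /inP[l ->]; exact: cutM.
by move=> U /inP[i ->]; exact: (imprimitive_restriction_fiber f_ge2 A_linked A_groups i).
Qed.
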